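(* For every integer $n>1$ that is not prime, there exists a proper planar metric $\rho$ on $\mathbb{R}^2$ with $\chi((\mathbb{R}^2,\rho),\{1\})=n$; i.e. $\mathsf{PLANAR}^*$ contains all non-prime integers greater than $1$.
   Context: A planar metric is a metric $\rho$ on $\mathbb{R}^2$ that is translation invariant ($\rho(x,y)=\rho(x+v,y+v)$ for all $x,y,v$) and induces the usual topology on $\mathbb{R}^2$; it is proper if its closed balls are compact. $\chi(X,\{1\})$ is the chromatic number of the graph on $X$ in which $x\sim y$ iff their distance equals $1$. $\mathsf{PLANAR}^*$ is the set of such chromatic numbers over proper planar metrics. *)

(* Defs.v *)
From mathcomp Require Import all_boot all_order all_algebra.
From mathcomp Require Import all_classical all_reals all_analysis.

Set Implicit Arguments.
Unset Strict Implicit.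
Unset Printing Implicit Defensive.

Import Order.TTheory GRing.Theory Num.Theory.
Import numFieldTopology.Exports numFieldNormedType.Exports.

Local Open Scope classical_set_scope.
Local Open Scope ring_scope.

(* Metrics are functions rather than instances of metricType: the plane
   R * R already carries its canonical (product) topology, with which the
   topology induced by the metric has to be compared. The fields are those of
   the factory isMetric; nonnegativity follows from them. *)
Record is_metric (R : realType) (X : Type) (d : X -> X -> R) : Prop :=
  IsMetric {
    dist_refl : forall x, d x x = 0 ;
    dist_eq0 : forall x y, d x y = 0 -> x = y ;
    dist_sym : forall x y, d x y = d y x ;
    dist_triangle : forall x y z, d x z <= d x y + d y z
  }.

Definition metric_open (R : realType) (X : Type) (d : X -> X -> R)
    (U : set X) : Prop :=
  forall x, U x -> exists2 e : R, 0 < e & [set y | d x y < e] `<=` U.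

Record planar_metric (R : realType) (rho : R * R -> R * R -> R) : Prop :=
  PlanarMetric {
    planar_is_metric : is_metric rho ;
    planar_translation : forall x y v, rho x y = rho (x + v) (y + v) ;
    planar_topology : forall U : set (R * R), metric_open rho U <-> open U
  }.

(* [compact] refers to the usual topology of the plane; for a planar metric
   this is the topology of the metric. *)
Definition proper_metric (R : realType) (rho : R * R -> R * R -> R) : Prop :=
  forall (x : R * R) (r : R), compact [set y | rho x y <= r].

Definition unit_distance (R : realType) (X : Type) (d : X -> X -> R)
    (x y : X) : Prop :=
  d x y = 1.

Definition colorable (X : Type) (adj : X -> X -> Prop) (n : nat) : Prop :=
  exists c : X -> 'I_n, forall x y, adj x y -> c x <> c y.

Definition has_chromatic_number (X : Type) (adj : X -> X -> Prop) (n : nat) :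
    Prop :=
  colorable adj n /\ forall m : nat, colorable adj m -> (n <= m)%N.

(* Main.v *)
Require Import Defs.
From mathcomp Require Import all_boot all_order all_algebra.
From mathcomp Require Import all_classical all_reals all_analysis.
From mathcomp Require Import lra zify.

(** Write n = a * b with a, b > 1. On the line, the length
    |t|_c = max (min |t| 1) (|t| / c) with c = a - 1 is a maximum of two
    subadditive functions, hence subadditive, and |t|_c = 1 exactly when
    1 <= |t| <= a - 1. Thus 0, 1, ..., a - 1 form a clique of the unit distance
    graph, while colouring t by its floor modulo a is proper. The maximum of
    two such lengths, one per coordinate, has unit distance graph containing
    the clique {0, ..., a - 1} x {0, ..., b - 1} and properly coloured by pairs
    of colours. *)

Set Implicit Arguments.
Unset Strict Implicit.
Unset Printing Implicit Defensive.

Import Order.TTheory GRing.Theory Num.Theory.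
Import numFieldTopology.Exports numFieldNormedType.Exports.

Local Open Scope classical_set_scope.
Local Open Scope ring_scope.

Lemma colorable_card (X : Type) (adj : X -> X -> Prop) (T : finType)
    (c : X -> T) :
  (forall x y, adj x y -> c x <> c y) -> colorable adj #|T|.
Proof. by move=> cP; exists (enum_rank \o c) => x y /cP cxy /enum_rank_inj. Qed.

(** A proper colouring separates adjacent points, so its composite with [g] is injective. *)
Lemma clique_colorable_le (X : Type) (adj : X -> X -> Prop) (T : finType)
    (g : T -> X) (m : nat) :
  (forall s t, s != t -> adj (g s) (g t)) -> colorable adj m -> (#|T| <= m)%N.
Proof.
move=> gP [c cP]; rewrite -[m]card_ord; apply: (@leq_card _ _ (c \o g)).
by move=> s t cst; apply/eqP/negPn/negP => /gP /cP.
Qed.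

Section PlateauLength.
Variable R : realType.
Implicit Types (c e r s t x y : R).

(** For [1 <= c] the graph rises to height 1, is flat for [1 <= |t| <= c], then grows with slope
    [1 / c]. The unbounded last piece keeps balls bounded, which properness requires. *)
Definition plateau c t := Num.max (Num.min `|t| 1) (`|t| / c).

Lemma plateau0 c : plateau c 0 = 0.
Proof. by rewrite /plateau normr0 mul0r min_l ?maxxx. Qed.

Lemma plateauN c t : plateau c (- t) = plateau c t.
Proof. by rewrite /plateau normrN. Qed.

Lemma plateau_le_norm c t : 1 <= c -> plateau c t <= `|t|.
Proof.
move=> c1; rewrite ge_max ge_min lexx /= ler_pdivrMr ?(lt_le_trans ltr01) //.
by rewrite ler_peMr.
Qed.

Lemma norm_le_plateau c t r : 0 < c -> plateau c t <= r -> `|t| <= r * c.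
Proof. by move=> c0; rewrite ge_max => /andP[_]; rewrite ler_pdivrMr. Qed.

(** Below height 1 the truncation by [min] is inactive; hence the condition [e <= 1]. *)
Lemma norm_lt_plateau c t e : e <= 1 -> plateau c t < e -> `|t| < e.
Proof.
move=> e1; rewrite gt_max => /andP[+ _]; rewrite gt_min.
case/orP=> [//|/lt_le_trans].
by move=> /(_ _ e1); rewrite ltxx.
Qed.

Lemma plateau_ge0 c t : 0 <= plateau c t.
Proof. by rewrite le_max le_min normr_ge0 ler01. Qed.

Lemma plateau_eq0 c t : plateau c t = 0 -> t = 0.
Proof.
move=> ct0; apply/eqP; rewrite -normr_le0 leNgt; apply/negP => t0.
by move: ct0; apply/eqP; rewrite gt_eqF // lt_max lt_min t0 ltr01.
Qed.

Lemma plateauD c s t : 0 < c -> plateau c (s + t) <= plateau c s + plateau c t.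
Proof.
move=> c0; have st := ler_normD s t.
rewrite /plateau ge_max; apply/andP; split; last first.
  apply: (@le_trans _ _ (`|s| / c + `|t| / c)).
    by rewrite -mulrDl ler_wpM2r // invr_ge0 ltW.
  by rewrite lerD // le_max lexx orbT.
apply: (@le_trans _ _ (Num.min `|s| 1 + Num.min `|t| 1)); last first.
  by rewrite lerD // le_max lexx.
have s0 := normr_ge0 s; have t0 := normr_ge0 t.
(* If [|s|] or [|t|] is at least 1, the right-hand side is at least 1; otherwise it is
   [|s| + |t|]. *)
by rewrite ge_min; case: (leP `|s| 1); case: (leP `|t| 1) => ? ?;
  apply/orP; (left; lra) || (right; lra).
Qed.

Lemma plateau_eq1 c t : 1 <= c -> plateau c t = 1 -> 1 <= `|t| <= c.
Proof.
move=> c1 ct1; rewrite -[X in X <= `|t|]ct1 plateau_le_norm //=.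
by rewrite -[c in _ <= c]mul1r norm_le_plateau ?ct1 ?(lt_le_trans ltr01).
Qed.

Lemma eq1_plateau c t : 0 < c -> 1 <= `|t| <= c -> plateau c t = 1.
Proof.
move=> c0 /andP[t1 tc].
by rewrite /plateau min_r // max_l // ler_pdivrMr // mul1r.
Qed.

Definition plateau_dist c d (p q : R * R) :=
  Num.max (plateau c (p.1 - q.1)) (plateau d (p.2 - q.2)).

Section PlateauDist.
Variables c d : R.
Hypotheses (c_ge1 : 1 <= c) (d_ge1 : 1 <= d).

Let c_gt0 : 0 < c. Proof. exact: lt_le_trans c_ge1. Qed.
Let d_gt0 : 0 < d. Proof. exact: lt_le_trans d_ge1. Qed.

Lemma plateau_dist_metric : is_metric (plateau_dist c d).
Proof.
split.
- by move=> x; rewrite /plateau_dist !subrr !plateau0 maxxx.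
- move=> [x1 x2] [y1 y2]; rewrite /plateau_dist /= => xy0.
  have /andP[xy1 xy2] :
      (plateau c (x1 - y1) <= 0) && (plateau d (x2 - y2) <= 0).
    by rewrite -ge_max xy0.
  congr (_, _); apply/eqP; rewrite -subr_eq0; apply/eqP.
    by apply: (@plateau_eq0 c); apply/eqP; rewrite eq_le xy1 plateau_ge0.
  by apply: (@plateau_eq0 d); apply/eqP; rewrite eq_le xy2 plateau_ge0.
- move=> x y; rewrite /plateau_dist -plateauN opprB.
  by rewrite -[in X in Num.max _ X]plateauN opprB.
- move=> x y z; rewrite /plateau_dist ge_max.
  have := plateauD (x.1 - y.1) (y.1 - z.1) c_gt0.
  have := plateauD (x.2 - y.2) (y.2 - z.2) d_gt0.
  rewrite !subrKA => H2 H1; apply/andP; split.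
    by apply: (le_trans H1); apply: lerD; rewrite le_max lexx.
  by apply: (le_trans H2); apply: lerD; rewrite le_max lexx orbT.
Qed.

Lemma plateau_dist_open (U : set (R * R)) :
  metric_open (plateau_dist c d) U <-> open U.
Proof.
rewrite openE; split=> UP x /UP.
  move=> [e e0 eU]; apply/nbhs_ballP; exists e => // y.
  rewrite /ball /= /prod_ball -!ball_normE /= => -[xy1 xy2].
  by apply: eU; rewrite /= /plateau_dist gt_max;
    apply/andP; split; apply: le_lt_trans (plateau_le_norm _ _) _.
(* Capping the radius at 1 stays below the plateau, where [norm_lt_plateau] applies. *)
move=> /nbhs_ballP[e /= e0 eU]; exists (Num.min e 1).
  by rewrite lt_min e0 /=.
move=> y /=; rewrite /plateau_dist gt_max => /andP[xy1 xy2]; apply: eU.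
rewrite /ball /= /prod_ball -!ball_normE /=.
by split; [move: xy1|move: xy2] => /norm_lt_plateau;
  rewrite ge_min lexx orbT lt_min => /(_ isT) /andP[].
Qed.

Lemma plateau_dist_planar : planar_metric (plateau_dist c d).
Proof.
split; [exact: plateau_dist_metric | | exact: plateau_dist_open].
move=> [x1 x2] [y1 y2] [v1 v2]; rewrite /plateau_dist /=.
have shift (s t v : R) : s + v - (t + v) = s - t.
  by rewrite opprD addrACA subrr addr0.
by rewrite !shift.
Qed.

(** A closed ball is closed by the triangle inequality and the agreement of topologies, and it lies
    in a compact rectangle whose half-sides [r * c] and [r * d] come from [norm_le_plateau]. *)
Lemma plateau_dist_proper : proper_metric (plateau_dist c d).
Proof.
move=> x r; set B := [set y | _].
have Bclosed : closed B.
  rewrite -openC; apply/plateau_dist_open => y /= /negP; rewrite -ltNge => ry.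
  exists (plateau_dist c d x y - r); first by rewrite subr_gt0.
  move=> z /=; rewrite ltrBrDl => yz; apply/negP; rewrite -ltNge.
  have := dist_triangle plateau_dist_metric x z y.
  by rewrite (dist_sym plateau_dist_metric z); lra.
pose K := `[x.1 - r * c, x.1 + r * c] `*` `[x.2 - r * d, x.2 + r * d].
apply: (@subclosed_compact _ _ K) => //.
  by apply: compact_setX; exact: segment_compact.
move=> y; rewrite /B /= /plateau_dist ge_max => /andP[xy1 xy2].
have /(@norm_le_plateau _ _ _ c_gt0) := xy1.
have /(@norm_le_plateau _ _ _ d_gt0) := xy2.
by rewrite /K !ler_norml /= !in_itv /= => /andP[? ?] /andP[? ?]; split; lra.
Qed.

End PlateauDist.

(** The remainder is nonnegative and below [p.+1], so neither the absolute value nor [inord] alters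
    it. *)
Definition floor_mod p t : 'I_p.+1 := inord `|(Num.floor t %% p.+1%:Z)%Z|.

Lemma floor_mod_neq p s t :
  1 <= `|s - t| <= p%:R -> floor_mod p s <> floor_mod p t.
Proof.
wlog st : s t / t <= s.
  move=> H; have [/H//|ts] := leP t s.
  by rewrite distrC => /(H _ _ (ltW ts)) ne /esym.
rewrite ger0_norm ?subr_ge0 // => /andP[st1 stp] /(congr1 val).
rewrite /= !inordK; [|lia|lia] => st_mod.
have fs := Num.Theory.floor_itv s; have ft := Num.Theory.floor_itv t.
(* Taking floors changes [s - t] by strictly less than 1, and [1 <= s - t <= p]. So the difference
   of floors is not a multiple of [p.+1]. *)
have /andP[fst0 fstp] : 0 < Num.floor s - Num.floor t < p.+1%:Z.
  rewrite -!(ltr_int R) rmorphB /= -[(p.+1%:Z)%:~R]/(p.+1%:R : R) -natr1.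
  rewrite !intrD in fs ft.
  by apply/andP; split; lra.
have : (p.+1%:Z %| Num.floor s - Num.floor t)%Z.
  by rewrite -eqz_mod_dvd; apply/eqP; lia.
by move/dvdz_mod0P; rewrite modz_small ?(ltW fst0) // => f0; rewrite f0 in fst0.
Qed.

End PlateauLength.

Lemma chromatic_plateau_dist (R : realType) (p q : nat) :
  (0 < p)%N -> (0 < q)%N ->
  has_chromatic_number (unit_distance (plateau_dist (p%:R : R) q%:R))
    (p.+1 * q.+1).
Proof.
move=> p0 q0; have p1 : 1 <= p%:R :> R by rewrite ler1n.
have q1 : 1 <= q%:R :> R by rewrite ler1n.
have -> : (p.+1 * q.+1)%N = #|{: 'I_p.+1 * 'I_q.+1}|.
  by rewrite card_prod !card_ord.
split.
  apply: (@colorable_card _ _ _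
    (fun x : R * R => (floor_mod p x.1, floor_mod q x.2))).
  move=> x y; rewrite /unit_distance /plateau_dist => xy [c1 c2].
  (* The coordinate attaining the maximum has plateau length 1, so its colours differ. *)
  move: xy; case: leP => _ /plateau_eq1 => [/(_ q1)|/(_ p1)] /floor_mod_neq.
    exact.
  exact.
move=> m; pose g (i : 'I_p.+1 * 'I_q.+1) : R * R := (i.1%:R, i.2%:R).
apply: (@clique_colorable_le _ _ _ g) => -[i j] [k l] ijkl.
(* On [0, ..., u] the plateau length gives the discrete metric, so distinct grid points are at
   distance exactly 1. *)
have ord (u : nat) (a b : 'I_u.+1) : (0 < u)%N ->
    plateau (u%:R : R) (a%:R - b%:R) = (a != b)%:R.
  move=> u0; have [->|ab] := eqVneq; first by rewrite subrr plateau0.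
  apply: eq1_plateau; first by rewrite ltr0n.
  have -> : `|a%:R - b%:R| = `|(a%:Z - b%:Z)|%:~R :> R.
    by rewrite intr_norm rmorphB.
  rewrite -[1]/(1%:~R) -[u%:R]/(u%:Z%:~R) !ler_int.
  move: (ltn_ord a) (ltn_ord b) ab; rewrite -val_eqE /=; lia.
rewrite /unit_distance /plateau_dist /g /= !ord //.
move: ijkl; rewrite xpair_eqE.
by case: (i == k); case: (j == l) => //= _;
  rewrite ?(max_l ler01) ?(max_r ler01) ?maxxx.
Qed.

Theorem theorem1p8 (R : realType) (n : nat) (n_gt1 : (1 < n)%N)
    (n_nonprime : ~~ prime n) :
  exists rho : R * R -> R * R -> R,
    [/\ planar_metric rho,
        proper_metric rho &
        has_chromatic_number (unit_distance rho) n].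
Proof.
have [|[a /andP[a1 an] /dvdnP[b nE]]] := primePn n_nonprime.
  by rewrite ltnNge n_gt1.
have {an} b1 : (1 < b)%N by move: an n_gt1; rewrite nE; nia.
case: a b => [//|p] [//|q] in a1 b1 nE *; rewrite nE.
have p1 : 1 <= p%:R :> R by rewrite ler1n.
have q1 : 1 <= q%:R :> R by rewrite ler1n.
(* Each plateau ends at a factor minus one. Both factors exceed 1, so both ends are at least 1; the
   order follows [n = q.+1 * p.+1]. *)
exists (plateau_dist q%:R p%:R); split.
- exact: plateau_dist_planar.
- exact: plateau_dist_proper.
- exact: chromatic_plateau_dist.
Qed.
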